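(* Let $n\in\mathbb{N}$. For a pointed metric space $M$, the following statements are equivalent: (1) there is an $n$-dimensional linear subspace of $\mathrm{Lip}_0(M)$ contained in $\mathrm{SNA}(M)$; (2) $M$ contains at least $n+1$ points.
   Context: All vector spaces are real and $\mathbb{N}=\{1,2,\dots\}$. A pointed metric space $(M,\rho)$ is a metric space with at least 2 points and a distinguished point $0\in M$. $\mathrm{Lip}_0(M)$ is the Banach space of all Lipschitz functions $f:M\to\mathbb{R}$ with $f(0)=0$, normed by the Lipschitz constant $\|f\|=\sup\{|f(x)-f(y)|/\rho(x,y): x,y\in M,\ x\neq y\}$. A function $f\in\mathrm{Lip}_0(M)$ attains its norm strongly if there are $x\neq y$ in $M$ with $\|f\|=|f(x)-f(y)|/\rho(x,y)$; $\mathrm{SNA}(M)\subset\mathrm{Lip}_0(M)$ is the set of all such $f$. *)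

(* Defs.v *)
From HB Require Import structures.
From mathcomp Require Import all_boot all_order all_algebra.
From mathcomp Require Import boolp classical_sets functions cardinality reals.
From mathcomp Require Import topology normedtype.

Set Implicit Arguments.
Unset Strict Implicit.
Unset Printing Implicit Defensive.

Import Order.TTheory GRing.Theory Num.Theory.
Import numFieldNormedType.Exports.

Local Open Scope classical_set_scope.
Local Open Scope ring_scope.

Section Lipschitz.
Context {R : realType} {M : metricType R}.
Implicit Types f g : M -> R^o.

(* The library's [lipschitz f] requires the domain of f to be a normed
   module. *)
Definition is_lipschitz f :=
  exists k : R, forall x y, `|f x - f y| <= k * mdist x y.

Definition slope f (x y : M) : R := `|f x - f y| / mdist x y.

Definition lip_const f : R :=
  sup [set s | exists x y : M, x != y /\ s = slope f x y].

Lemma slope_le_lip_const f x y : is_lipschitz f -> x != y ->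
  slope f x y <= lip_const f.
Proof.
move=> [k fk] xy; apply: ub_le_sup; last by exists x, y.
by exists k => _ [a [b [ab ->]]]; rewrite /slope ler_pdivrMr ?mdist_gt0.
Qed.

Lemma lip_const_ge0 f : 0 <= lip_const f.
Proof.
rewrite /lip_const; set A := [set _ | _].
have [[A0 A1]|/sup_out ->//] := pselect (has_sup A).
have [s As] := A0; apply: le_trans (ub_le_sup A1 As).
by case: As => x [y [_ ->]]; rewrite divr_ge0 ?mdist_ge0.
Qed.

Lemma le_lip_const f x y : is_lipschitz f ->
  `|f x - f y| <= lip_const f * mdist x y.
Proof.
move=> fL; have [->|xy] := eqVneq x y.
  by rewrite subrr normr0 mdistxx mulr0.
by rewrite -ler_pdivrMr ?mdist_gt0 ?slope_le_lip_const.
Qed.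

Lemma lip_const_le f (k : R) : 0 <= k ->
  (forall x y, `|f x - f y| <= k * mdist x y) -> lip_const f <= k.
Proof.
move=> k0 fk; rewrite /lip_const; set A := [set _ | _].
have [->|/set0P A0] := eqVneq A set0; first by rewrite sup0.
apply: ge_sup => // _ [x [y [xy ->]]].
by rewrite /slope ler_pdivrMr ?mdist_gt0.
Qed.

Definition lip0 (o : M) : {pred M -> R^o} :=
  [pred f | `[< is_lipschitz f /\ f o = 0 >]].

Lemma lip0_submod_closed o : submod_closed (lip0 o).
Proof.
split=> [|a f g /asboolP[[k fk] f0] /asboolP[[l gl] g0]]; apply/asboolP; split.
- by exists 0 => x y; rewrite /= subrr normr0 mul0r.
- by [].
- exists (`|a| * k + l) => x y.
  have -> : (a *: f + g) x - (a *: f + g) y = a * (f x - f y) + (g x - g y).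
    by rewrite mulrBr opprD addrACA.
  rewrite (le_trans (ler_normD _ _))// mulrDl lerD// normrM -mulrA.
  by rewrite ler_wpM2l.
- have -> : (a *: f + g) o = a * f o + g o by [].
  by rewrite f0 g0 mulr0 addr0.
Qed.

HB.instance Definition _ o :=
  GRing.isSubmodClosed.Build _ _ (lip0 o) (lip0_submod_closed o).

End Lipschitz.

Record Lip0 {R : realType} {M : metricType R} (o : M) := MkLip0 {
  Lip0_fun :> M -> R^o;
  Lip0_funP : Lip0_fun \in lip0 o
}.

Section Lip0_normed.
Context {R : realType} {M : metricType R} (o : M).

HB.instance Definition _ := [isSub for @Lip0_fun R M o].
HB.instance Definition _ := [Choice of Lip0 o by <:].
HB.instance Definition _ := [SubChoice_isSubLmodule of Lip0 o by <:].

Implicit Types f g : Lip0 o.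

Lemma Lip0_lipschitz f : is_lipschitz f.
Proof. by case: f => f /= /asboolP[]. Qed.

Lemma Lip0_base f : f o = 0.
Proof. by case: f => f /= /asboolP[]. Qed.

Definition Lip0_norm f : R := lip_const f.

Lemma ler_Lip0_normD f g : Lip0_norm (f + g) <= Lip0_norm f + Lip0_norm g.
Proof.
apply: lip_const_le => [|x y]; first by rewrite addr_ge0 ?lip_const_ge0.
have -> : (f + g) x - (f + g) y = (f x - f y) + (g x - g y).
  by rewrite addrACA -opprD.
rewrite (le_trans (ler_normD _ _))// mulrDl.
by rewrite lerD// le_lip_const//; exact: Lip0_lipschitz.
Qed.

Lemma Lip0_normZ_le (a : R) f : Lip0_norm (a *: f) <= `|a| * Lip0_norm f.
Proof.
apply: lip_const_le => [|x y]; first by rewrite mulr_ge0 ?lip_const_ge0.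
have -> : (a *: f) x - (a *: f) y = a * (f x - f y) by rewrite mulrBr.
by rewrite normrM -mulrA ler_wpM2l// le_lip_const//; exact: Lip0_lipschitz.
Qed.

Lemma Lip0_normZ (a : R) f : Lip0_norm (a *: f) = `|a| * Lip0_norm f.
Proof.
apply/eqP; rewrite eq_le Lip0_normZ_le /=.
have [->|a0] := eqVneq a 0; first by rewrite normr0 mul0r lip_const_ge0.
rewrite -ler_pdivlMl ?normr_gt0// -normfV.
by rewrite -{1}[f]scale1r -(mulVf a0) -scalerA Lip0_normZ_le.
Qed.

Lemma Lip0_norm0_eq0 f : Lip0_norm f = 0 -> f = 0.
Proof.
move=> f0; apply: val_inj; apply/funext => x /=; apply/eqP.
move: (le_lip_const x o (Lip0_lipschitz f)).
by rewrite -/(Lip0_norm f) f0 mul0r Lip0_base subr0 normr_le0.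
Qed.

HB.instance Definition _ := @Lmodule_isNormed.Build R (Lip0 o)
  Lip0_norm ler_Lip0_normD Lip0_normZ Lip0_norm0_eq0.

Lemma Lip0_normE f : `|f| = lip_const f.
Proof. by []. Qed.

Definition SNA : set (Lip0 o) :=
  [set f : Lip0 o | exists x y : M, x != y /\ `|f| = slope f x y].

End Lip0_normed.
Arguments SNA {R M} o.

Section linear_subspace.
Context {R : realType} {E : lmodType R}.

Definition is_basis n (V : set E) (e : 'I_n -> E) :=
  (forall c : 'I_n -> R, \sum_(i < n) c i *: e i = 0 -> forall i, c i = 0) /\
  V = [set v | exists c : 'I_n -> R, v = \sum_(i < n) c i *: e i].

Definition linear_subspace_dim (n : nat) (V : set E) :=
  submod_closed [in V] /\ exists e : 'I_n -> E, is_basis V e.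

End linear_subspace.

(* Main.v *)
From HB Require Import structures.
Require Import Defs.
From mathcomp Require Import all_boot all_order all_algebra perm.
From mathcomp Require Import boolp classical_sets functions cardinality reals.
From mathcomp Require Import topology normedtype.
From mathcomp Require Import zify ring lra.

(** If [M] is finite with [m] points, a function in [Lip0 o] is determined by
its values at the [m - 1] points other than [o], and every function on [M] is
Lipschitz and attains its norm, because only finitely many slopes compete.
Hence SNA is the whole space, of dimension [m - 1], and both directions are
linear algebra ([finite_SNA_subspace], [free_Lip0_lt_size]).

If [M] is infinite, (2) always holds, and the task is to find an
[n]-dimensional subspace inside SNA for every [n]. The subspace constructed is
an isometric copy of l_1^n. Suppose that [e_1, ..., e_n] are 1-Lipschitz and
that for each of the [2 ^ n] sign patterns [s] there is a pair [a != b] with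
[e_i a - e_i b = s_i * mdist a b] for all [i] at once. Then a combination
[\sum_i c_i e_i] has Lipschitz constant at most [\sum_i `|c_i|], and reaches
this value at the pair that belongs to the signs of [c] ([l1_SNA]).

To get such pairs, take [2 * 2 ^ n] distinct points and match them in pairs so
that the sum of the distances within the pairs is minimal
([minimal_matching]). For a fixed [i], orient each pair by the [i]-th sign of
its pattern, as a source [a_s] and a target [b_s]. Sending the sources to the
targets along any permutation is again a matching of the same points, so it
costs at least as much as [a_s -> b_s]: the matching is an optimal transport
plan, for every orientation. Kantorovich duality then yields a 1-Lipschitz
function on [M] that falls by exactly [mdist a_s b_s] from [a_s] to [b_s] for
all [s] ([kantorovich_potential]); this is [e_i], up to a constant. The
orientation changes with [i] while the matching does not, so the [e_i] share
their pairs.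

The dual solution comes from the absence of negative cycles in the graph on
the pairs with weights [mdist a_s b_t - mdist a_s b_s]: permutation-optimality
says that simple cycles are nonnegative, every closed walk splits into simple
ones, and then the infimum of the weights of the walks out of a vertex is a
finite potential ([potential]). *)

Set Implicit Arguments.
Unset Strict Implicit.
Unset Printing Implicit Defensive.
Import Order.TTheory GRing.Theory Num.Theory.
Local Open Scope classical_set_scope.
Local Open Scope card_scope.
Local Open Scope ring_scope.

(** * Potentials on weighted graphs without negative cycles *)

Lemma repeated_entry (T : eqType) (s : seq T) : ~~ uniq s ->
  exists s1 x s2 s3, s = s1 ++ x :: s2 ++ x :: s3.
Proof.
elim: s => //= y s IHs; rewrite negb_and negbK => /orP[ys|/IHs].
  by case/splitPr: ys => s2 s3; exists [::], y, s2, s3.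
by move=> [s1 [x [s2 [s3 ->]]]]; exists (y :: s1), x, s2, s3.
Qed.

Section Potential.
Context {R : realType} {I : finType}.
Variable w : I -> I -> R.

Fixpoint walk_weight (x : I) (p : seq I) : R :=
  if p is y :: q then w x y + walk_weight y q else 0.

Lemma walk_weight_cat x p q :
  walk_weight x (p ++ q) = walk_weight x p + walk_weight (last x p) q.
Proof.
by elim: p x => [|y p IHp] x /=; rewrite ?add0r// IHp addrA.
Qed.

Lemma walk_weight_rcons x p y :
  walk_weight x (rcons p y) = walk_weight x p + w (last x p) y.
Proof. by rewrite -cats1 walk_weight_cat /= addr0. Qed.

(** The closing vertex [x0] is separate from [x] so that the induction goes
through; for [x0 = x], [next_at y x x p] is [next (x :: p) y]. *)
Lemma walk_weight_uniq x0 x p : uniq (x :: p) ->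
  walk_weight x (rcons p x0) = \sum_(y <- x :: p) w y (next_at y x0 x p).
Proof.
elim: p x => [|y p IHp] x /= => [_|/and3P[]].
  by rewrite big_seq1 eqxx addr0.
rewrite inE negb_or => /andP[xy xp] yp up.
rewrite IHp/= ?yp// [RHS]big_cons eqxx; congr +%R.
rewrite big_seq [RHS]big_seq; apply: eq_bigr => z zyp.
by have [zx|//] := eqVneq z x; move: zyp; rewrite zx inE (negPf xy) (negPf xp).
Qed.

Hypothesis w_diag : forall x, w x x = 0.
Hypothesis w_perm : forall s : {perm I}, 0 <= \sum_x w x (s x).

(** A simple closed walk is the cycle of a permutation that fixes all other
vertices, and these contribute nothing since [w] vanishes on the diagonal. *)
Lemma simple_closed_walk_ge0 x p : uniq (x :: p) ->
  0 <= walk_weight x (rcons p x).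
Proof.
move=> up; rewrite walk_weight_uniq// big_uniq//.
have nextI : injective (next (x :: p)) := can_inj (prev_next up).
apply: le_trans (w_perm (perm nextI)) _; rewrite le_eqVlt; apply/orP; left.
apply/eqP; rewrite [RHS]big_mkcond; apply: eq_bigr => y _; rewrite permE.
by case: ifPn => // yp; rewrite next_nth (negPf yp) w_diag.
Qed.

(** At a repeated vertex, a closed walk splits into two shorter closed
walks. *)
Lemma closed_walk_ge0 x p : 0 <= walk_weight x (rcons p x).
Proof.
have [m] := ubnP (size p); elim: m => // m IHm in x p *; rewrite ltnS => pm.
have [/simple_closed_walk_ge0//|/repeated_entry] := boolP (uniq (x :: p)).
move=> [[|y s1] [z [s2 [s3]]]] /= [xz pE]; subst; move: pm;
  rewrite !size_cat /= ?size_cat /= => pm.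
- rewrite rcons_cat -cat_rcons walk_weight_cat last_rcons.
  by apply: addr_ge0; apply: IHm; apply: leq_trans pm; lia.
- have -> : walk_weight y (rcons (s1 ++ z :: s2 ++ z :: s3) y) =
      walk_weight z (rcons s2 z) + walk_weight y (rcons (s1 ++ z :: s3) y).
    rewrite !rcons_cat /= rcons_cat /= !walk_weight_cat /= !walk_weight_cat /=.
    rewrite !walk_weight_rcons; ring.
  apply: addr_ge0; apply: IHm; apply: leq_trans pm; rewrite ?size_cat/=; lia.
Qed.

(** [g x] is the infimum of the weights of all walks that start at [x], with
arbitrary end; prefixing the edge from [x] to [y] gives the inequality. The
infimum is finite because closing up a walk by one edge back to [x] makes its
weight nonnegative. *)
Lemma potential : exists g : I -> R, forall x y, g x <= w x y + g y.
Proof.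
pose g x := inf [set walk_weight x p | p in [set: seq I]].
have lb x : has_lbound [set walk_weight x p | p in [set: seq I]].
  exists (- \sum_y `|w y x|) => _ [p _ <-].
  have := closed_walk_ge0 x p; rewrite walk_weight_rcons => p0.
  have : w (last x p) x <= \sum_y `|w y x|.
    apply: le_trans (ler_norm _) _.
    by rewrite (bigD1 (last x p))//= lerDl sumr_ge0.
  lra.
exists g => x y; rewrite -lerBlDl; apply: lb_le_inf.
  by exists 0, [::].
by move=> _ [p _ <-]; rewrite lerBlDl; apply: ge_inf => //; exists (y :: p).
Qed.

End Potential.

(** * Optimal transport and minimal matchings *)

Section Kantorovich.
Context {R : realType} {M : metricType R} {I : finType}.

(** Prescribing the values [g i] at the targets [b i] leads to the largest
1-Lipschitz function [f] below these values, [f x = min_i (g i + mdist x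
(b i))]. A potential [g] for the excess costs [mdist (a i) (b j) - mdist (a i)
(b i)] is what makes the minimum at [a i] be reached at the index [i]. *)
Lemma kantorovich_potential (i0 : I) (a b : I -> M) :
  (forall s : {perm I},
    \sum_i mdist (a i) (b i) <= \sum_i mdist (a i) (b (s i))) ->
  exists f : M -> R, (forall x y, `|f x - f y| <= mdist x y) /\
    (forall i, f (a i) - f (b i) = mdist (a i) (b i)).
Proof.
move=> ab_opt.
have [||g gP] := @potential R I
    (fun i j => mdist (a i) (b j) - mdist (a i) (b i)).
- by move=> i; rewrite subrr.
- by move=> s; rewrite sumrB subr_ge0.
pose h x i := g i + mdist x (b i).
pose f x := h x [arg min_(i < i0) h x i]%O.
have f_le x i : f x <= h x i.
  by rewrite /f; case: Order.TotalTheory.arg_minP => // j _; exact.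
have f_lip x y : f x - f y <= mdist x y.
  rewrite lerBlDl {2}/f; set j := [arg min_(_ < _) _]%O.
  apply: le_trans (f_le x j) _; rewrite /h -addrA lerD2l addrC.
  exact: metric_triangle.
exists f; split=> [x y|i].
  by rewrite ler_norml f_lip andbT lerNl opprB metric_sym f_lip.
apply/eqP; rewrite eq_le f_lip /= {1}/f; set j := [arg min_(_ < _) _]%O.
have := f_le (b i) i; rewrite /h mdistxx addr0 => fbi.
have := gP i j; lra.
Qed.

(** The point [q (i, c)] is matched with [q (i, ~~ c)], and [o] chooses a
source in each pair. The same [q] serves all orientations because reassigning
the targets along [s] only produces another matching of the same points. *)
Lemma minimal_matching (p : I * bool -> M) : injective p ->
  exists2 q : I * bool -> M, injective q &
  forall (o : I -> bool) (s : {perm I}),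
    \sum_i mdist (q (i, o i)) (q (i, ~~ o i)) <=
    \sum_i mdist (q (i, o i)) (q (s i, ~~ o (s i))).
Proof.
move=> p_inj.
pose cost (t : {perm I * bool}) :=
  \sum_i mdist (p (t (i, true))) (p (t (i, false))).
pose t := [arg min_(t < (1%g : {perm I * bool})) cost t]%O.
have t_min u : cost t <= cost u.
  by rewrite /t; case: Order.TotalTheory.arg_minP => // j _; exact.
have costE (o : I -> bool) u :
    cost u = \sum_i mdist (p (u (i, o i))) (p (u (i, ~~ o i))).
  by apply: eq_bigr => i _; case: (o i) => //=; rewrite metric_sym.
exists (fun x => p (t x)) => [x y /p_inj /perm_inj//|o s].
rewrite -costE.
(* [r] keeps every source in place and moves the targets along [s]. *)
pose r x := if x.2 == o x.1 then x else (s x.1, ~~ o (s x.1)).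
have r_inj : injective r.
  move=> [i c] [j d]; rewrite /r /=.
  case: eqP => [->|/eqP ci]; case: eqP => [->|/eqP dj] //.
  - by move=> [-> /esym/eqP]; rewrite -addbT; case: (o _).
  - by move=> [<- /eqP]; case: (o _).
  - move=> [/perm_inj ij _]; subst j; congr pair.
    by move: ci dj; case: c; case: d; case: (o i).
apply: le_trans (t_min (perm r_inj * t)%g) _; rewrite (costE o) le_eqVlt.
apply/orP; left; apply/eqP; apply: eq_bigr => i _.
by rewrite !permM !permE /r /= eqxx; case: (o i).
Qed.

End Kantorovich.

(** * Copies of l_1 consisting of strongly norm-attaining functions *)

Section Subspaces.
Context {R : realType} {M : metricType R} (o : M).

Lemma linear_span_dim (E : lmodType R) n (e : 'I_n -> E) :
  (forall c : 'I_n -> R, \sum_(i < n) c i *: e i = 0 -> forall i, c i = 0) ->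
  linear_subspace_dim n
    [set v | exists c : 'I_n -> R, v = \sum_(i < n) c i *: e i].
Proof.
move=> e_free; split; last by exists e.
split=> [|k u v]; rewrite !inE/=.
  by exists (fun=> 0); rewrite big1// => i _; rewrite scale0r.
move=> [c ->] [d ->]; exists (fun i => k * c i + d i).
rewrite scaler_sumr -big_split; apply: eq_bigr => i _ /=.
by rewrite scalerDl scalerA.
Qed.

Lemma Lip0_combE n (c : 'I_n -> R) (e : 'I_n -> Lip0 o) x :
  (\sum_(i < n) c i *: e i) x = \sum_(i < n) c i * e i x.
Proof.
by elim/big_ind2: _ => //= f a g b <- <-.
Qed.

Lemma exists_Lip0 (f : M -> R) : is_lipschitz f ->
  exists g : Lip0 o, forall x, g x = f x - f o.
Proof.
move=> [k fk].
have gP : (fun x => f x - f o) \in lip0 o.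
  apply/asboolP; split; last by rewrite subrr.
  by exists k => x y; rewrite opprB addrA subrK.
by exists (MkLip0 gP).
Qed.

(** The hypotheses say that [e] spans l_1^n isometrically, with the norm of
each combination attained. Freeness comes with it: a vanishing combination has
[\sum_i `|c i| = 0] as one of its slopes. *)
Lemma l1_SNA n (e : 'I_n -> Lip0 o) :
  (forall i x y, `|e i x - e i y| <= mdist x y) ->
  (forall s : {ffun 'I_n -> bool}, exists a b, a != b /\
     forall i, e i a - e i b = (-1) ^+ s i * mdist a b) ->
  exists V : set (Lip0 o), linear_subspace_dim n V /\ V `<=` SNA o.
Proof.
move=> e_lip e_sign.
have attained (c : 'I_n -> R) : exists a b, a != b /\
    slope (\sum_(i < n) c i *: e i : Lip0 o) a b = \sum_i `|c i|.
  have [a [b [ab sE]]] := e_sign [ffun i => c i < 0]; exists a, b; split=> //.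
  rewrite /slope !Lip0_combE -sumrB.
  under eq_bigr do rewrite -mulrBr sE ffunE mulrA mulrC [c _ * _]mulrC
    -normrEsign.
  rewrite -mulr_sumr normrM ger0_norm ?mdist_ge0//.
  by rewrite mulrAC divff ?gt_eqF ?mdist_gt0// mul1r ger0_norm ?sumr_ge0.
exists [set v | exists c : 'I_n -> R, v = \sum_(i < n) c i *: e i]; split.
  apply: linear_span_dim => c c0 i.
  have [a [b [_]]] := attained c; rewrite c0 /slope subrr normr0 mul0r.
  move/esym/eqP; rewrite psumr_eq0// => /allP/(_ i).
  by rewrite mem_index_enum normr_eq0 => /(_ isT)/eqP.
move=> _ [c ->]; have [a [b [ab sE]]] := attained c; exists a, b; split=> //.
apply/eqP; rewrite eq_le {2}Lip0_normE slope_le_lip_const// ?andbT; last first.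
  exact: Lip0_lipschitz.
rewrite sE Lip0_normE; apply: lip_const_le => [|x y]; first exact: sumr_ge0.
rewrite !Lip0_combE -sumrB mulr_suml (le_trans (ler_norm_sum _ _ _))//.
by apply: ler_sum => i _; rewrite -mulrBr normrM ler_wpM2l.
Qed.

(** The pairs are indexed by the sign patterns themselves: the [i]-th function
is a potential for the orientation where [s i] picks the source of the pair
[s]. *)
Lemma SNA_subspace_of_pairs n (p : {ffun 'I_n -> bool} * bool -> M) :
  injective p ->
  exists V : set (Lip0 o), linear_subspace_dim n V /\ V `<=` SNA o.
Proof.
move=> /minimal_matching[q q_inj q_opt].
have fP i : exists f : M -> R, (forall x y, `|f x - f y| <= mdist x y) /\
    forall s : {ffun 'I_n -> bool},
      f (q (s, s i)) - f (q (s, ~~ s i)) = mdist (q (s, s i)) (q (s, ~~ s i)).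
  exact: kantorovich_potential [ffun=> true] _ _ (q_opt (fun s => s i)).
have eP i : exists g : Lip0 o, (forall x y, `|g x - g y| <= mdist x y) /\
    forall s : {ffun 'I_n -> bool},
      g (q (s, s i)) - g (q (s, ~~ s i)) = mdist (q (s, s i)) (q (s, ~~ s i)).
  have [f [f_lip fE]] := fP i; have [|g gE] := @exists_Lip0 f.
    by exists 1 => x y; rewrite mul1r.
  by exists g; split=> [x y|s]; rewrite !gE opprB addrA subrK.
have [e eE] := choice eP; apply: (@l1_SNA n e) => [i|s]; first exact: (eE i).1.
exists (q (s, false)), (q (s, true)); split=> [|i].
  by apply/eqP => /q_inj.
have := (eE i).2 s; case: (s i) => /= [E|->]; last by rewrite expr0 mul1r.
by rewrite expr1 mulN1r metric_sym -E opprB.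
Qed.

End Subspaces.

(** * Finite metric spaces *)

Section Finite.
Context {R : realType} {M : metricType R} (o : M).
Variable s : seq M.
Hypothesis s_full : forall x, x \in s.

Lemma finite_max_slope (f : M -> R) : (exists x : M, x != o) ->
  exists x y : M, x != y /\
    forall x' y', x' != y' -> slope f x' y' <= slope f x y.
Proof.
move=> [x1 x1o].
pose P (k : seq_sub s * seq_sub s) := val k.1 != val k.2.
have P0 : P (SeqSub (s_full x1), SeqSub (s_full o)) by [].
have [[x y] /= xy xy_max] := Order.TotalTheory.arg_maxP
  (fun k : seq_sub s * seq_sub s => slope f (val k.1) (val k.2)) P0.
exists (val x), (val y); split=> // x' y' xy'.
exact: (xy_max (SeqSub (s_full x'), SeqSub (s_full y'))).
Qed.

Lemma finite_lipschitz (f : M -> R) : is_lipschitz f.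
Proof.
have [[x1 x1o]|no] := pselect (exists x : M, x != o).
  have [|x [y [xy f_max]]] := @finite_max_slope f; first by exists x1.
  exists (slope f x y) => x' y'; have [->|xy'] := eqVneq x' y'.
    by rewrite subrr normr0 mdistxx mulr0.
  by rewrite -ler_pdivrMr ?mdist_gt0// f_max.
have eq_o x : x = o by apply/eqP/negPn/negP => xo; apply: no; exists x.
by exists 0 => x y; rewrite (eq_o x) (eq_o y) subrr normr0 mul0r.
Qed.

Lemma finite_SNA (f : Lip0 o) : (exists x : M, x != o) -> SNA o f.
Proof.
move=> M2; have [x [y [xy f_max]]] := finite_max_slope f M2.
exists x, y; split=> //; apply/eqP; rewrite eq_le Lip0_normE.
rewrite slope_le_lip_const ?andbT//; last exact: Lip0_lipschitz.
apply: lip_const_le => [|x' y']; first by rewrite divr_ge0// mdist_ge0.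
have [->|xy'] := eqVneq x' y'; first by rewrite subrr normr0 mdistxx mulr0.
by rewrite -ler_pdivrMr ?mdist_gt0// f_max.
Qed.

Hypothesis s_uniq : uniq s.

(** The indicator functions of [n] points other than [o] are free. *)
Lemma finite_SNA_subspace n : (0 < n)%N -> (n < size s)%N ->
  exists V : set (Lip0 o), linear_subspace_dim n V /\ V `<=` SNA o.
Proof.
move=> n0 ns; pose x (i : 'I_n) := nth o (rem o s) i.
have i_lt (i : 'I_n) : (i < size (rem o s))%N.
  by rewrite size_rem// ltn_predRL; exact: leq_ltn_trans (ltn_ord i) ns.
have x_o i : x i != o.
  by have := mem_nth o (i_lt i); rewrite mem_rem_uniq// inE => /andP[].
have x_inj i j : (x i == x j) = (i == j).
  by rewrite nth_uniq ?rem_uniq.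
have eP i : exists g : Lip0 o, forall y, g y = (y == x i)%:R.
  have [g gE] := exists_Lip0 o (finite_lipschitz (fun y => (y == x i)%:R)).
  by exists g => y; rewrite gE [o == _]eq_sym (negPf (x_o i)) subr0.
have [e eE] := choice eP.
exists [set v | exists c : 'I_n -> R, v = \sum_(i < n) c i *: e i]; split.
  apply: linear_span_dim => c c0 i.
  have := Lip0_combE c e (x i); rewrite c0 (bigD1 i)//= big1 => [|j ji].
    by rewrite eE eqxx mulr1 addr0 => /esym.
  by rewrite eE x_inj eq_sym (negPf ji) mulr0.
by move=> v _; apply: finite_SNA; exists (x (Ordinal n0)).
Qed.

(** The matrix of values at the points other than [o] has [size s - 1] columns,
so [size s] or more rows are linearly dependent, and a combination of [e] that
vanishes at these points vanishes everywhere. *)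
Lemma free_Lip0_lt_size n (e : 'I_n -> Lip0 o) :
  (forall c : 'I_n -> R, \sum_(i < n) c i *: e i = 0 -> forall i, c i = 0) ->
  (n < size s)%N.
Proof.
move=> e_free; rewrite ltnNge; apply/negP => sn.
pose A := \matrix_(i < n, j < size (rem o s)) (e i (nth o (rem o s) j) : R).
have : kermx A != 0.
  rewrite kermx_eq0 /row_free neq_ltn (leq_ltn_trans (rank_leq_col A))//.
  by rewrite size_rem// prednK//; case: (s) (s_full o).
move=> /rowV0Pn[c /sub_kermxP cA /eqP]; apply; apply/rowP => i; rewrite mxE.
apply: (e_free (c 0)); apply/val_inj/funext => x /=; rewrite Lip0_combE.
have [->|xo] := eqVneq x o.
  by rewrite big1// => j _; rewrite Lip0_base mulr0.
have xs : x \in rem o s by rewrite mem_rem_uniq// !inE xo s_full.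
have xsz : (index x (rem o s) < size (rem o s))%N by rewrite index_mem.
move: cA => /rowP/(_ (Ordinal xsz)); rewrite !mxE => cA.
by rewrite -[RHS]cA; apply: eq_bigr => j _; rewrite mxE /= nth_index.
Qed.

End Finite.

(** * Counting points *)

Section Cardinality.
Context {T : choiceType} (x0 : T).

Lemma card_le_injective k : reflect (exists p : 'I_k -> T, injective p)
  (`I_k #<= [set: T]).
Proof.
pose T' : pointedType := HB.pack_for pointedType T (isPointed.Build T x0).
apply: (iffP (@pcard_injP _ T' _)) => [[f f_inj]|[p p_inj]].
  exists (fun i => f i) => i j fij; apply/val_inj/f_inj => //; rewrite ?inE/=.
  - exact: ltn_ord.
  - exact: ltn_ord.
exists (fun j => if insub j is Some i then p i else x0) => i j.
rewrite !inE /= => ik jk; rewrite (insubT (fun m => m < k)%N ik).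
by rewrite (insubT (fun m => m < k)%N jk) => /p_inj/(congr1 val).
Qed.

Lemma card_le_size (s : seq T) k : (forall x, x \in s) -> uniq s ->
  (`I_k #<= [set: T]) = (k <= size s)%N.
Proof.
move=> s_full s_uniq; apply/card_le_injective/idP => [[p p_inj]|ks].
  have := uniq_leq_size (s1 := codom p) (s2 := s).
  by rewrite size_codom card_ord; apply=> //; exact/injectiveP.
exists (fun i : 'I_k => nth x0 s i) => i j /eqP.
rewrite nth_uniq// => [/eqP/val_inj//||]; exact: leq_trans (ltn_ord _) ks.
Qed.

End Cardinality.

(** * Linear subspaces of strongly norm-attaining functions *)

Theorem corollary2p8 (R : realType) (M : metricType R) (o : M)
    (M_ge2 : `I_2 #<= [set: M]) (n : nat) (n_gt0 : (0 < n)%N) :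
  (exists V : set (Lip0 o), linear_subspace_dim n V /\ V `<=` SNA o) <->
  `I_n.+1 #<= [set: M].
Proof.
have [/finite_seqP[s0 s0E]|/infiniteP M_inf] := pselect (finite_set [set: M]).
  have s_full x : x \in undup s0.
    by rewrite mem_undup; have : [set: M] x by []; rewrite s0E.
  have s_uniq := undup_uniq s0.
  rewrite (card_le_size o _ s_full)//; split=> [[V [[_ [e [e_free _]]] _]]|].
    exact: (free_Lip0_lt_size s_full s_uniq e_free).
  exact: (finite_SNA_subspace o s_full s_uniq n_gt0).
have M_le k : `I_k #<= [set: M].
  by apply: card_le_trans M_inf; exact: subset_card_le.
split=> // _.
have [p p_inj] :=
  card_le_injective o _ (M_le #|{: {ffun 'I_n -> bool} * bool}|).
apply: (@SNA_subspace_of_pairs _ _ _ n (p \o enum_rank)).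
exact: inj_comp p_inj enum_rank_inj.
Qed.
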